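(* Let $(\mathbf n_i)_{i\in\mathbb N}$ be a sequence in $\mathbb N^d$ such that (i) for each $j\in\{1,\dots,d\}$ the index of the lowest nonzero binary digit of $n^j_i$ tends to infinity as $i\to\infty$, and (ii) each $\mathbf n_i$ lies in some block $B_{k_i}=\{\mathbf n: 2^{k_i}\mathbf 1\le\mathbf n<2^{k_i+1}\mathbf 1\}$ with $k_i\to\infty$. Then the set $F=\{\mathbf g\in\mathbb G^d: W_{\mathbf n_i}(\mathbf g)=1\text{ for all }i\}$ is a $U$-set for the $d$-dimensional Walsh system with respect to $\lambda$-convergence for some $\lambda\in[1,2]$, and, if $\mathbf n_i=n_i\mathbf 1$ for all $i$, even with respect to convergence by cubes.
   Context: Fix an integer $d\ge 2$. $\mathbb G$ is the dyadic group: sequences $g=(g_k)_{k\ge0}$, $g_k\in\{0,1\}$, coordinatewise addition mod 2, product topology; $\mathbb G^d$ its $d$-th power. For $n\in\mathbb N_0$, $n=\sum_kn_k2^k$ with $n_k\in\{0,1\}$ its binary digits. Vector order coordinatewise, $\mathbf 1=(1,\dots,1)$. Walsh functions $W_n(g)=\prod_k(-1)^{g_kn_k}$, $W_{\mathbf n}(\mathbf g)=\prod_{l=1}^dW_{n^l}(g^l)$. A $d$-fold Walsh series is $\sum_{\mathbf n\in\mathbb N_0^d}a_{\mathbf n}W_{\mathbf n}$ with partial sums $S_{\mathbf N}(\mathbf g)=\sum_{\mathbf n<\mathbf N}a_{\mathbf n}W_{\mathbf n}(\mathbf g)$, $\mathbf N\in\mathbb N^d$. For $\lambda\ge1$, the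 series $\lambda$-converges to $S$ at $\mathbf g$ if $S_{\mathbf N}(\mathbf g)\to S$ as $\min_jN^j\to\infty$ with $\max_{j,k}N^j/N^k\le\lambda$; convergence by cubes means $S_{N\mathbf 1}(\mathbf g)\to S$ as $N\to\infty$. A set $A\subset\mathbb G^d$ is a $U$-set (for a given convergence type) if every Walsh series converging to $0$ at every point of $\mathbb G^d\setminus A$ has all coefficients equal to zero. *)

(* Defs.v *)
From HB Require Import structures.
From mathcomp Require Import all_boot all_order all_algebra.
From mathcomp Require Import reals.
Set Implicit Arguments. Unset Strict Implicit. Unset Printing Implicit Defensive.
Import Order.TTheory GRing.Theory Num.Theory.
Local Open Scope ring_scope.

Definition dyadic := nat -> bool.
Definition dpoint (d : nat) := 'I_d -> dyadic.
Definition mindex (d : nat) := {ffun 'I_d -> nat}.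

Definition bit (n k : nat) : bool := odd (n %/ 2 ^ k).

(* One-dimensional Walsh function W_n(g) = prod_k (-1)^(g_k n_k).
   Binary digits of n of index k >= n vanish, so the product over k < n suffices. *)
Definition walsh1 (R : nzRingType) (n : nat) (g : dyadic) : R :=
  \prod_(k < n) (-1) ^+ (g k && bit n k).

Definition walsh (R : nzRingType) (d : nat) (n : mindex d) (g : dpoint d) : R :=
  \prod_(l < d) walsh1 R (n l) (g l).

Definition psum (R : nzRingType) (d : nat) (a : mindex d -> R) (N : 'I_d -> nat)
    (g : dpoint d) : R :=
  \sum_(m : {ffun 'I_d -> 'I_(\max_(j < d) N j)%N} | [forall j, (m j < N j)%N])
     a [ffun j => nat_of_ord (m j)] * walsh R [ffun j => nat_of_ord (m j)] g.

Definition lambda_conv0 (R : realType) (d : nat) (lam : R) (a : mindex d -> R)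
    (g : dpoint d) : Prop :=
  forall eps : R, 0 < eps -> exists M : nat, forall N : 'I_d -> nat,
    (forall j, (M <= N j)%N) ->
    (forall j k, (N j)%:R <= lam * (N k)%:R) ->
    `|psum a N g| < eps.

Definition cube_conv0 (R : realType) (d : nat) (a : mindex d -> R) (g : dpoint d) : Prop :=
  forall eps : R, 0 < eps -> exists M : nat, forall N : nat, (M <= N)%N ->
    `|psum a (fun _ => N) g| < eps.

Definition U_set_lambda (R : realType) (d : nat) (lam : R) (A : dpoint d -> Prop) : Prop :=
  forall a : mindex d -> R,
    (forall g, ~ A g -> lambda_conv0 lam a g) -> forall n, a n = 0.

Definition U_set_cube (R : realType) (d : nat) (A : dpoint d -> Prop) : Prop :=
  forall a : mindex d -> R,
    (forall g, ~ A g -> cube_conv0 a g) -> forall n, a n = 0.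

(* Main.v *)
Require Import Defs.
From HB Require Import structures.
From mathcomp Require Import all_boot all_order all_algebra.
From mathcomp Require Import boolp reals.
From mathcomp Require Import zify ring lra.
Import Order.TTheory GRing.Theory Num.Theory.
Local Open Scope ring_scope.

(** Two ways of averaging partial sums [S_N] over a dyadic cube [Q] of rank [s] drive the proof, together
    with the remark that every average is dominated in modulus by some value on [Q].

    - The average of [S_(2^K)] over [Q] is the value of [S_(2^s)] on [Q]. If the latter is nonzero and [Q]
      misses [F], shrinking cubes give a point off [F] where [S_(2^r)] does not tend to [0]. Hence [S_(2^s)]
      vanishes wherever some [W_(n_i) <> 1] with [n_i < 2^s].
    - If [2^s] divides [n_i] and [t <= s], the average of [S_(n_i + 2^t) W_(n_i)] over [Q] only sees the
      frequencies [n_i + p] with [p < 2^t]; by the first point, multiplying the large dyadic sums by [W_(n_i)]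
      changes nothing, so this average is the value of [S_(2^t)] on [Q]. If that value is nonzero, shrinking
      cubes inside the complement of [F] (which is dense) give a point off [F] where [S_(n_i + 2^t)] does not
      tend to [0].

    The sums [S_(n_i + 2^t)] are sums over cubes if [n_i] is diagonal; in general
    [2^(k_i) <= n_i + 2^t <= 2^(k_i + 1)] coordinatewise, so that they are admissible for [lambda = 2]. *)

(** * Binary digits *)

Lemma bitD (m k l : nat) : bit m (k + l) = bit (m %/ 2 ^ k) l.
Proof. by rewrite /bit expnD divnMA. Qed.

Lemma bit_small (m k l : nat) : (m < 2 ^ k)%N -> (k <= l)%N -> bit m l = false.
Proof.
move=> mk kl; rewrite /bit divn_small //.
by apply: leq_trans mk _; rewrite leq_exp2l.
Qed.

Lemma bit_top (m k : nat) : (2 ^ k <= m < 2 ^ k.+1)%N -> bit m k.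
Proof.
move=> /andP[k1 k2]; rewrite /bit (_ : m %/ 2 ^ k = 1)%N //.
by apply/eqP; rewrite eqn_leq leq_divRL ?expn_gt0 // mul1n k1 -ltnS
  ltn_divLR ?expn_gt0 // -expnS k2.
Qed.

Lemma bit_inj (m n : nat) : (forall k, bit m k = bit n k) -> m = n.
Proof.
elim/ltn_ind: m n => m IH n e.
have oe : odd m = odd n by have := e 0%N; rewrite /bit expn0 !divn1.
have he : m./2 = n./2.
  case: (posnP m) => [m0|m0]; last first.
    apply: IH => [|k]; first by lia.
    by have := e (1 + k)%N; rewrite !bitD expn1 !divn2.
  subst m; case: (posnP n) => [->//|n0].
  have := bit_top n _ (trunc_log_bounds (isT : (1 < 2)%N) n0).
  by rewrite -e /bit div0n.
by rewrite -(odd_double_half m) -(odd_double_half n) oe he.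
Qed.

Lemma bits_eq_divn (s K x u : nat) : (x < 2 ^ K)%N -> (u < 2 ^ K)%N ->
  (forall b, (s <= b < K)%N -> bit x b = bit u b) <-> (x %/ 2 ^ s = u %/ 2 ^ s)%N.
Proof.
move=> xK uK; split=> [e|e b /andP[sb _]]; last by rewrite -(subnKC sb) !bitD e.
apply: bit_inj => k; rewrite -!bitD.
have [skK|Ksk] := ltnP (s + k) K; first by apply: e; rewrite leq_addr.
by rewrite (bit_small _ _ _ xK) ?(bit_small _ _ _ uK).
Qed.

(** No carry occurs: the digits of [u] sit at indices at least [s], those of [p] below [s]. *)
Lemma bit_addb (s u p b : nat) : (2 ^ s %| u)%N -> (p < 2 ^ s)%N ->
  bit (u + p) b = bit u b (+) bit p b.
Proof.
move=> su ps; have [bs|sb] := ltnP b s.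
  by rewrite /bit divnDl ?oddD // (dvdn_trans _ su) // dvdn_exp2l // ltnW.
rewrite (bit_small _ _ _ ps sb) addbF -(subnKC sb) !bitD divnDl //.
by rewrite (divn_small ps) addn0.
Qed.

(** * One-dimensional Walsh functions *)

Section Walsh1.
Context {R : realFieldType}.

Lemma walsh1_prod (K m : nat) (g : dyadic) : (m < 2 ^ K)%N ->
  walsh1 R m g = \prod_(k < K) (-1) ^+ (g k && bit m k).
Proof.
move=> mK; rewrite /walsh1.
pose f k : R := (-1) ^+ (g k && bit m k).
have widen K' L : (m < 2 ^ K')%N ->
    \prod_(k < K') f k = \prod_(k < K' + L) f k.
  move=> mK'; rewrite big_split_ord /= [X in _ * X]big1 ?mulr1 // => i _.
  by rewrite /f (bit_small _ _ _ mK') ?leq_addr // andbF.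
transitivity (\prod_(k < m + K) f k); first exact: widen (ltn_expl m _).
by rewrite addnC; symmetry; apply: widen.
Qed.

Lemma walsh1_flip (m c : nat) (g : dyadic) :
  walsh1 R m (fun b => g b (+) (b == c)) = (-1) ^+ bit m c * walsh1 R m g.
Proof.
have mK : (m < 2 ^ (m + c.+1))%N.
  by apply: leq_trans (ltn_expl m (isT : (1 < 2)%N)) _; rewrite leq_exp2l ?leq_addr.
rewrite !(walsh1_prod _ _ _ mK).
have cK : (c < m + c.+1)%N by lia.
rewrite (bigD1 (Ordinal cK)) //= [X in _ = _ * X](bigD1 (Ordinal cK)) //= eqxx.
rewrite mulrA; congr (_ * _).
  by case: (g c); case: (bit m c); rewrite /= ?mulr1 ?mul1r ?expr1 ?expr0 ?mulrNN ?mulr1.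
apply: eq_bigr => i ic; rewrite (_ : (i == c :> nat) = false) ?addbF //.
by apply: contraNF ic => /eqP e; apply/eqP/val_inj.
Qed.

Lemma walsh1D (s u p : nat) (g : dyadic) : (2 ^ s %| u)%N -> (p < 2 ^ s)%N ->
  walsh1 R (u + p) g = walsh1 R u g * walsh1 R p g.
Proof.
move=> su ps; have h := ltn_expl (u + p) (isT : (1 < 2)%N).
rewrite !(walsh1_prod (u + p)) ?(leq_ltn_trans _ h) ?leq_addr ?leq_addl //.
rewrite -big_split /=; apply: eq_bigr => k _.
by rewrite (bit_addb _ _ _ _ su ps) -signr_addb; case: (g k).
Qed.

Lemma walsh1_local (s m : nat) (g h : dyadic) : (m < 2 ^ s)%N ->
  (forall b, (b < s)%N -> g b = h b) -> walsh1 R m g = walsh1 R m h.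
Proof.
by move=> ms gh; rewrite !(walsh1_prod _ _ _ ms); apply: eq_bigr => b _; rewrite gh.
Qed.

Lemma walsh1_sqr (m : nat) (g : dyadic) : walsh1 R m g * walsh1 R m g = 1.
Proof.
rewrite /walsh1 -big_split /= big1 // => k _.
by rewrite -expr2 -exprM mulnC exprM sqrrN expr1n expr1n.
Qed.

End Walsh1.

(** * Multiple Walsh functions and dyadic cubes *)

Section Walsh.
Context {R : realFieldType} {d : nat}.
Implicit Types (g h : dpoint d) (x u : mindex d) (a : mindex d -> R).

Definition addm (u x : mindex d) : mindex d := [ffun j => (u j + x j)%N].

(** The points [h] related to [g] form the dyadic cube of rank [s] around [g]. *)
Definition eq_below (s : nat) (g h : dpoint d) : Prop :=
  forall j b, (b < s)%N -> g j b = h j b.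

Definition flip (c : 'I_d * nat) (g : dpoint d) : dpoint d :=
  fun j b => g j b (+) ((j, b) == c).

Lemma eq_below_le (s t : nat) g h : (s <= t)%N -> eq_below t g h -> eq_below s g h.
Proof. by move=> st e j b bs; apply: e; apply: leq_trans st. Qed.

Lemma eq_below_trans (s : nat) g1 g2 g3 :
  eq_below s g1 g2 -> eq_below s g2 g3 -> eq_below s g1 g3.
Proof. by move=> e1 e2 j b bs; rewrite e1 ?e2. Qed.

Lemma eq_below_flip (s : nat) (c : 'I_d * nat) g : (s <= c.2)%N -> eq_below s g (flip c g).
Proof.
move=> sc j b bs; rewrite /flip; case: eqP => [e|_]; last by rewrite addbF.
by move: sc bs; rewrite -e /=; lia.
Qed.

Lemma walsh_flip u (c : 'I_d * nat) g :
  walsh R u (flip c g) = (-1) ^+ bit (u c.1) c.2 * walsh R u g.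
Proof.
case: c => j b /=; rewrite /walsh (bigD1 j) //= [X in _ = _ * X](bigD1 j) //= mulrA.
rewrite -walsh1_flip; congr (_ * _).
  congr (walsh1 R _ _); apply/funext => k; rewrite /flip.
  by rewrite xpair_eqE eqxx.
apply: eq_bigr => l lj; congr (walsh1 R _ _); apply/funext => k.
by rewrite /flip xpair_eqE (negbTE lj) addbF.
Qed.

Lemma walshD (s : nat) u x g : (forall j, 2 ^ s %| u j)%N -> (forall j, x j < 2 ^ s)%N ->
  walsh R (addm u x) g = walsh R u g * walsh R x g.
Proof.
move=> su xs; rewrite /walsh -big_split /=; apply: eq_bigr => j _.
by rewrite ffunE (walsh1D s).
Qed.

Lemma walsh_local (s : nat) u g h : (forall j, u j < 2 ^ s)%N ->
  eq_below s g h -> walsh R u g = walsh R u h.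
Proof.
move=> us gh; rewrite /walsh; apply: eq_bigr => j _.
by apply: (walsh1_local s) => // b; apply: gh.
Qed.

Lemma walsh_sqr u g : walsh R u g * walsh R u g = 1.
Proof. by rewrite /walsh -big_split /= big1 // => j _; rewrite walsh1_sqr. Qed.

Lemma normr_walsh u g : `|walsh R u g| = 1.
Proof.
by apply/eqP; rewrite -sqrp_eq1 // -normrX expr2 walsh_sqr normr1.
Qed.

Lemma walsh0 g : walsh R [ffun=> 0%N] g = 1.
Proof. by rewrite /walsh big1 // => j _; rewrite ffunE /walsh1 big_ord0. Qed.

(** * Partial sums over boxes and their averages over cubes *)

Definition box (N : 'I_d -> nat) : seq (mindex d) :=
  let M := (\max_(j < d) N j)%N in
  [seq [ffun j => nat_of_ord (m j)] | m : {ffun 'I_d -> 'I_M} <-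
    enum [pred m : {ffun 'I_d -> 'I_M} | [forall j, (m j < N j)%N]]].

Lemma psumE a (N : 'I_d -> nat) g : psum a N g = \sum_(x <- box N) a x * walsh R x g.
Proof. by rewrite /box big_map big_enum; apply: eq_bigl => m; rewrite inE. Qed.

Lemma box_uniq (N : 'I_d -> nat) : uniq (box N).
Proof.
rewrite map_inj_uniq ?enum_uniq // => m1 m2 e.
by apply/ffunP => j; move/ffunP/(_ j): e; rewrite !ffunE => /val_inj.
Qed.

Lemma mem_box (N : 'I_d -> nat) x : (x \in box N) = [forall j, x j < N j]%N.
Proof.
apply/mapP/forallP => [[m]|xN].
  by rewrite mem_enum inE => /forallP mN -> j; rewrite ffunE.
have xm j : (x j < \max_(j < d) N j)%N by rewrite (leq_trans (xN j)) // leq_bigmax.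
exists [ffun j => Ordinal (xm j)].
  by rewrite mem_enum inE; apply/forallP => j; rewrite ffunE; apply: xN.
by apply/ffunP => j; rewrite !ffunE.
Qed.

Lemma psum_local (s : nat) a (N : 'I_d -> nat) g h : (forall j, N j <= 2 ^ s)%N ->
  eq_below s g h -> psum a N g = psum a N h.
Proof.
move=> Ns gh; rewrite !psumE; apply: eq_big_seq => x; rewrite mem_box => /forallP xN.
by rewrite (walsh_local s x g h) // => j; rewrite (leq_trans (xN j)).
Qed.

Fixpoint avg (cs : seq ('I_d * nat)) (f : dpoint d -> R) (g : dpoint d) : R :=
  if cs is c :: cs' then (avg cs' f g + avg cs' f (flip c g)) / 2 else f g.

(* Averaging over these flips is averaging over the cube of rank [s], for functions of the first [K] bits. *)
Definition free_bits (s K : nat) : seq ('I_d * nat) :=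
  [seq (j, b) | j <- enum 'I_d, b <- iota s (K - s)].

Lemma eq_avg cs (f1 f2 : dpoint d -> R) : f1 =1 f2 -> avg cs f1 =1 avg cs f2.
Proof. by move=> e; elim: cs => //= c cs IH g; rewrite !IH. Qed.

Lemma avg_sum (I : Type) (r : seq I) (a : I -> R) (f : I -> dpoint d -> R) cs g :
  avg cs (fun h => \sum_(i <- r) a i * f i h) g = \sum_(i <- r) a i * avg cs (f i) g.
Proof.
elim: cs g => //= c cs IH g; rewrite !IH -big_split mulr_suml.
by apply: eq_bigr => i _; rewrite /= -mulrDr mulrA.
Qed.

(** A flip at [c] multiplies the product by -1 exactly when the digits of [x] and [u] at [c] differ,
    and one such flip cancels the whole mean. *)
Lemma avg_walshM x u cs g :
  avg cs (fun h => walsh R x h * walsh R u h) g =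
  if all (fun c => bit (x c.1) c.2 == bit (u c.1) c.2) cs
  then walsh R x g * walsh R u g else 0.
Proof.
elim: cs g => //= c cs IH g; rewrite !IH !walsh_flip.
case: all; rewrite ?andbF ?andbT /=; last by rewrite addr0 mul0r.
case: (bit (x _) _); case: (bit (u _) _); rewrite /= ?expr0 ?expr1; by field.
Qed.

(** At each flip, keep the half of larger modulus; flips at indices at least [s] do not leave the
    cube of rank [s]. *)
Lemma avg_le_norm (s : nat) cs (f : dpoint d -> R) g :
  all (fun c => s <= c.2)%N cs -> exists2 h, eq_below s g h & `|avg cs f g| <= `|f h|.
Proof.
elim: cs g => [|c cs IH] g /=; first by exists g.
move=> /andP[sc scs].
have [h1 e1 le1] := IH g scs; have [h2 e2 le2] := IH (flip c g) scs.
have e2' := eq_below_trans _ _ _ _ (eq_below_flip _ _ g sc) e2.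
have tri : `|(avg cs f g + avg cs f (flip c g)) / 2| <= (`|f h1| + `|f h2|) / 2.
  rewrite normrM [X in _ * X]ger0_norm ?invr_ge0 // ler_pM2r ?invr_gt0 //.
  by rewrite (le_trans (ler_normD _ _)) // lerD.
have [h12|h21] := leP `|f h1| `|f h2|; [exists h2|exists h1] => //; lra.
Qed.

Lemma all_free_bits (s K : nat) (P : pred ('I_d * nat)) :
  reflect (forall j b, (s <= b < K)%N -> P (j, b)) (all P (free_bits s K)).
Proof.
apply: (iffP allP) => [H j b sbK|H [j b] /allpairsP[[j' b'] /= [_ bi [-> ->]]]].
  apply: H; apply/allpairsP; exists (j, b); split=> //=; first by rewrite mem_enum.
  by rewrite mem_iota; lia.
by apply: H; move: bi; rewrite mem_iota; lia.
Qed.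

(* Only the frequencies [u + p] with [p < 2 ^ s] survive the averaging. *)
Lemma avg_psum a (s K : nat) u (N L : 'I_d -> nat) g :
  (forall j, 2 ^ s %| u j)%N -> (forall j, u j < 2 ^ K)%N -> (forall j, N j <= 2 ^ K)%N ->
  (forall j p, (p < L j) = (p < 2 ^ s) && (u j + p < N j))%N ->
  avg (free_bits s K) (fun h => psum a N h * walsh R u h) g =
  psum (fun x => a (addm u x)) L g.
Proof.
move=> su uK NK LE.
pose P x := all (fun c => bit (x c.1) c.2 == bit (u c.1) c.2) (free_bits s K).
have boxL x : x \in box L ->
    [/\ forall j, (x j < 2 ^ s)%N, forall j, (u j + x j < N j)%N & P (addm u x)].
  rewrite mem_box => /forallP xL.
  have xs j : (x j < 2 ^ s)%N by have := xL j; rewrite LE => /andP[].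
  have xN j : (u j + x j < N j)%N by have := xL j; rewrite LE => /andP[].
  split=> //; apply/all_free_bits => j b sb; apply/eqP => /=; rewrite ffunE.
  apply: (iffRL (bits_eq_divn s K _ _ _ _)) sb => //; first exact: leq_trans (NK j).
  by rewrite divnDl // (divn_small (xs j)) addn0.
under (eq_avg _ _ (fun h => \sum_(x <- box N) a x * (walsh R x h * walsh R u h))).
  by move=> h; rewrite psumE mulr_suml; apply: eq_bigr => x _; rewrite mulrA.
rewrite avg_sum psumE.
under eq_bigr => x _ do rewrite avg_walshM -/(P x).
rewrite (bigID P) /= [X in _ + X]big1 ?addr0; last first.
  by move=> x /negbTE ->; rewrite mulr0.
rewrite -big_filter.
rewrite (perm_big (map (addm u) (box L))) /=; last first.
  apply: uniq_perm; first exact/filter_uniq/box_uniq.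
    rewrite map_inj_uniq ?box_uniq // => x y /ffunP e; apply/ffunP => j.
    by have := e j; rewrite !ffunE => /addnI.
  move=> y; rewrite mem_filter mem_box.
  apply/andP/mapP => [[Py /forallP yN]|[x xL ->]].
    (* Agreement with [u] on the digits from [s] to [K] means equal quotients by [2 ^ s], so [y] is
       [u] plus its own remainder. *)
    have yu j : (y j %/ 2 ^ s = u j %/ 2 ^ s)%N.
      apply/(bits_eq_divn s K) => // [|b sb]; first exact: leq_trans (NK j).
      by apply/eqP; move/all_free_bits: Py => /(_ j b sb).
    have uE j : (u j = y j %/ 2 ^ s * 2 ^ s)%N by rewrite yu divnK.
    have yE : y = addm u [ffun j => (y j %% 2 ^ s)%N].
      by apply/ffunP => j; rewrite !ffunE uE -divn_eq.
    exists [ffun j => (y j %% 2 ^ s)%N] => //; rewrite mem_box; apply/forallP => j.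
    by rewrite LE !ffunE ltn_mod expn_gt0 /= uE -divn_eq.
  have [_ xN Px] := boxL x xL; split=> //.
  by apply/forallP => j; rewrite ffunE.
rewrite big_map; apply: eq_big_seq => x xL; have [xs _ Px] := boxL x xL.
by rewrite Px (walshD s) // mulrAC walsh_sqr mul1r.
Qed.

End Walsh.

(* The events [E i] are forced one after another on shrinking cubes, and hold together at the common point. *)
Lemma nested_cubes {d : nat} (good : dpoint d -> nat -> Prop) (E : nat -> dpoint d -> Prop)
    (g0 : dpoint d) (s0 : nat) :
  good g0 s0 ->
  (forall g s M, good g s -> exists h s' i,
     [/\ (M <= i)%N, (s < s')%N, eq_below s g h, good h s' &
         forall h', eq_below s' h h' -> E i h']) ->
  exists2 h, eq_below s0 g0 h & forall M, exists2 i, (M <= i)%N & E i h.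
Proof.
move=> good0 step; pose cube := {x : dpoint d * nat | good x.1 x.2}.
have next (M : nat) (x : cube) : {y : cube | exists i,
    [/\ (M <= i)%N, ((sval x).2 < (sval y).2)%N,
        eq_below (sval x).2 (sval x).1 (sval y).1 &
        forall h', eq_below (sval y).2 (sval y).1 h' -> E i h']}.
  apply: cid; case: x => -[g s] /= gs.
  have [h [s' [i [Mi ss' gh hs' Ei]]]] := step g s M gs.
  by exists (exist _ (h, s') hs'), i.
pose fix c k : cube :=
  if k is k'.+1 then sval (next k' (c k')) else exist _ (g0, s0) good0.
pose p k := (sval (c k)).1; pose r k := (sval (c k)).2.
have cS k : exists i, [/\ (k <= i)%N, (r k < r k.+1)%N, eq_below (r k) (p k) (p k.+1) &
    forall h', eq_below (r k.+1) (p k.+1) h' -> E i h'].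
  exact: svalP (next k (c k)).
have r_ge k : (k <= r k)%N.
  by elim: k => // k IH; have [i [_ lt _ _]] := cS k; apply: leq_ltn_trans lt.
have pD k l : eq_below (r k) (p k) (p (k + l)%N) /\ (r k <= r (k + l))%N.
  elim: l => [|l [IHp IHr]]; first by rewrite addn0.
  have [i [_ lt e _]] := cS (k + l)%N; rewrite addnS; split; last by lia.
  exact: eq_below_trans IHp (eq_below_le _ _ _ _ IHr e).
(* Digit [b] is already final at stage [b.+1], because [r b.+1 >= b.+1 > b]. *)
pose h : dpoint d := fun j b => p b.+1 j b.
have ph k : eq_below (r k) (p k) h.
  move=> j b br; rewrite /h; have [kb|bk] := leqP k b.+1.
    by have [e _] := pD k (b.+1 - k)%N; rewrite subnKC // in e; apply: e.
  have [e _] := pD b.+1 (k - b.+1)%N; rewrite subnKC ?(ltnW bk) // in e.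
  by rewrite e.
exists h; first exact: (ph 0%N).
move=> M; have [i [Mi _ _ Ei]] := cS M; exists i => //; exact/Ei/ph.
Qed.

(** * Uniqueness for series with null partial sums off [F] *)

Section SupportedSeries.
Context {R : realFieldType} {d : nat}.
Context (a : mindex d -> R) (n : nat -> mindex d) (k : nat -> nat).
Context (d_gt0 : (0 < d)%N).
Context (n_low : forall M, exists I, forall i, (I <= i)%N ->
  forall j, (M <= logn 2 (n i j))%N).
Context (k_oo : forall M, exists I, forall i, (I <= i)%N -> (M <= k i)%N).
Context (n_block : forall i j, (2 ^ k i <= n i j < 2 ^ (k i).+1)%N).

Let F (g : dpoint d) : Prop := forall i, walsh R (n i) g = 1.
Let pow2 (s : nat) : 'I_d -> nat := fun=> (2 ^ s)%N.

(** These two hypotheses are what both halves of the theorem have in common: 2-convergence supplies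
    them, and so does convergence by cubes when the [n i] are diagonal. *)
Context (dyadic_cvg : forall g, ~ F g -> forall eps, 0 < eps ->
  exists M, forall s, (M <= s)%N -> `|psum a (pow2 s) g| < eps).
Context (shifted_cvg : forall g, ~ F g -> forall t eps, 0 < eps ->
  exists M, forall i, (M <= i)%N -> `|psum a (fun j => n i j + 2 ^ t)%N g| < eps).

Let addm0 (x : mindex d) : addm [ffun=> 0%N] x = x.
Proof. by apply/ffunP => j; rewrite !ffunE. Qed.

(** This is [avg_psum] with [u = 0], whose Walsh function is constantly 1. *)
Lemma avg_psum_pow2 (s K : nat) (g : dpoint d) : (s <= K)%N ->
  avg (free_bits s K) (psum a (pow2 K)) g = psum a (pow2 s) g.
Proof.
move=> sK; under eq_avg => h do rewrite -[psum _ _ _]mulr1 -(walsh0 h).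
rewrite (avg_psum _ _ _ _ _ (pow2 s)) //.
- by rewrite !psumE; apply: eq_bigr => x _; rewrite addm0.
- by move=> j; rewrite ffunE.
- by move=> j; rewrite ffunE expn_gt0.
- move=> j p; rewrite ffunE add0n /pow2; case: ltnP => //= ps.
  by rewrite (leq_trans ps) // leq_exp2l.
Qed.

Lemma psum_pow2_off_support (g : dpoint d) (i s : nat) :
  walsh R (n i) g <> 1 -> (forall j, n i j < 2 ^ s)%N -> psum a (pow2 s) g = 0.
Proof.
move=> Wg ns; apply/eqP; apply: contrapT => /negP Sg.
pose c := `|psum a (pow2 s) g|.
have c0 : 0 < c by rewrite normr_gt0.
have [||h gh hE] := @nested_cubes d (fun h r => c <= `|psum a (pow2 r) h|)
  (fun r h => c <= `|psum a (pow2 r) h|) g s; first exact: lexx.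
  move=> h r M cr; pose r' := maxn M r.+1.
  have rr' : (r <= r')%N by rewrite /r'; lia.
  have [|h' hh' le] := avg_le_norm r (free_bits r r') (psum a (pow2 r')) h.
    by apply/all_free_bits => j b /andP[].
  rewrite avg_psum_pow2 // in le.
  exists h', r', r'; split=> //; try by rewrite /r'; lia.
    exact: le_trans le.
  by move=> h'' e; rewrite -(psum_local r' _ _ h' h'') //; apply: le_trans le.
(* As [n i < 2 ^ s], the function [W_(n i)] is constant on the initial cube, so the limit point
   stays off [F]. *)
have nF : ~ F h by move/(_ i); rewrite -(walsh_local s _ g h).
have [M ltM] := dyadic_cvg _ nF _ c0.
by have [r Mr] := hE M; rewrite leNgt ltM.
Qed.

(** Take [k i >= t]: flipping digit [k i] of one coordinate stays in the cube and meets the leading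
    digit of [n i], so it changes the sign of [W_(n i)]. *)
Lemma complement_dense (g : dpoint d) (t : nat) :
  exists i h, eq_below t g h /\ walsh R (n i) h <> 1.
Proof.
have [i tk] := k_oo t; have {tk} tk := tk i (leqnn _).
have [Wg|Wg] := eqVneq (walsh R (n i) g) 1; last by exists i, g; split=> //; apply/eqP.
exists i, (flip (Ordinal d_gt0, k i) g); split; first exact: eq_below_flip.
rewrite walsh_flip Wg mulr1 /= (bit_top _ _ (n_block i _)) expr1.
by apply/eqP; rewrite -subr_eq0; apply/eqP; lra.
Qed.

(* On the cube of rank [t] the multiplier [W_(n i)] is invisible, because the large dyadic sums vanish wherever it differs from [1]. *)
Lemma psum_shift_pow2 (i t : nat) (g : dpoint d) : (forall j, 2 ^ t %| n i j)%N ->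
  psum (fun x => a (addm (n i) x)) (pow2 t) g = psum a (pow2 t) g.
Proof.
move=> tn; pose K := maxn t (k i).+1.
have tK : (t <= K)%N by rewrite /K; lia.
have nK j : (n i j < 2 ^ K)%N.
  have /andP[_ lt] := n_block i j; apply: leq_trans lt _.
  by rewrite leq_exp2l // /K; lia.
rewrite -(avg_psum a t K (n i) (pow2 K)) //; last first.
  move=> j p; rewrite /pow2; case: ltnP => //= pt; apply/esym.
  (* Both [n i j] and [2 ^ K] are multiples of [2 ^ t], so [n i j < 2 ^ K] leaves room for every
     [n i j + p] with [p < 2 ^ t]. *)
  have := nK j; rewrite -(divnK (tn j)) -{1 2}(subnK tK) expnD ltn_pmul2r ?expn_gt0 // => lt.
  rewrite (leq_trans _ (_ : (n i j %/ 2 ^ t).+1 * 2 ^ t <= _)%N) ?leq_pmul2r ?expn_gt0 //.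
  by rewrite mulSn addnC ltn_add2r.
rewrite -(avg_psum_pow2 t K) //; apply: eq_avg => h.
have [->|/eqP W1] := eqVneq (walsh R (n i) h) 1; first by rewrite mulr1.
by rewrite (psum_pow2_off_support h i) // mul0r.
Qed.

Lemma psum_pow2_eq0 (g : dpoint d) (t : nat) : psum a (pow2 t) g = 0.
Proof.
apply/eqP; apply: contrapT => /negP Sg.
pose c := `|psum a (pow2 t) g|.
have c0 : 0 < c by rewrite normr_gt0.
have [i0 [g1 [gg1 Wg1]]] := complement_dense g t.
(* Beyond rank [k i0], [W_(n i0)] is constant on the cube around [g1], which therefore misses
   [F]. *)
pose s1 := maxn t (k i0).+1.
have ts1 : (t <= s1)%N by rewrite /s1; lia.
have [||h gh hE] := @nested_cubes d (fun h s => eq_below s1 g1 h /\ (s1 <= s)%N)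
  (fun i h => c <= `|psum a (fun j => n i j + 2 ^ t)%N h|) g1 s1; first by split.
  move=> h s M [g1h s1s].
  have [I1 low] := n_low s; pose i := maxn M I1.
  have sn j : (2 ^ s %| n i j)%N.
    have /andP[n0 _] := n_block i j.
    rewrite pfactor_dvdn ?low ?leq_maxr //.
    by apply: leq_trans n0; rewrite expn_gt0.
  have ts := leq_trans ts1 s1s.
  (* Large enough that the shifted sum depends only on digits below [K], hence is constant on the
     next cube. *)
  pose K := (s + (k i).+2)%N.
  have NK j : (n i j + 2 ^ t <= 2 ^ K)%N.
    have /andP[_ lt] := n_block i j.
    have le1 : (2 ^ (k i).+1 + 2 ^ s <= 2 ^ K)%N.
      rewrite /K addnS [leqRHS]expnS mul2n -addnn leq_add // leq_exp2l //; lia.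
    have : (2 ^ t <= 2 ^ s)%N by rewrite leq_exp2l.
    lia.
  have [|h' hh' le] := avg_le_norm s (free_bits s K)
      (fun h => psum a (fun j => n i j + 2 ^ t)%N h * walsh R (n i) h) h.
    by apply/all_free_bits => j b /andP[].
  rewrite (avg_psum _ _ _ _ _ (pow2 t)) // in le; first last.
  - move=> j p; rewrite ltn_add2l /pow2; case: (ltnP p (2 ^ t)) => pt; last by rewrite andbF.
    by rewrite (leq_trans pt) // leq_exp2l.
  - by move=> j; apply: leq_trans (NK j); rewrite -[X in (X < _)%N]addn0 ltn_add2l expn_gt0.
  rewrite psum_shift_pow2 in le; last first.
    by move=> j; apply: dvdn_trans (sn j); rewrite dvdn_exp2l.
  rewrite normrM normr_walsh mulr1 in le.
  rewrite -(psum_local t _ _ g h) // -/c in le; last first.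
    by apply: eq_below_trans gg1 _; apply: eq_below_le ts1 g1h.
  exists h', K, i; split=> //.
  - exact: leq_maxl.
  - by rewrite /K; lia.
  - split; last by rewrite /K; lia.
    exact: eq_below_trans g1h (eq_below_le _ _ _ _ s1s hh').
  - by move=> h'' e; rewrite -(psum_local K _ _ h' h'').
have nF : ~ F h.
  move/(_ i0); rewrite -(walsh_local s1 _ g1 h) // => j.
  have /andP[_ lt] := n_block i0 j; apply: leq_trans lt _.
  by rewrite leq_exp2l // /s1; lia.
have [M ltM] := shifted_cvg _ nF t _ c0.
by have [i Mi] := hE M; rewrite leNgt ltM.
Qed.

(** Fourier's formula: averaging a dyadic sum against [W_m] over the cube of rank 0, the whole
    group, leaves only the frequency [m]. *)
Lemma coef_eq0 (m : mindex d) : a m = 0.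
Proof.
pose g : dpoint d := fun _ _ => false; pose K := (\max_(j < d) m j)%N.
have mK j : (m j < 2 ^ K)%N.
  by apply: leq_ltn_trans (ltn_expl K _) => //; apply: leq_bigmax.
have := avg_psum a 0 K m (pow2 K) (pow2 0) g.
under eq_avg => h do rewrite psum_pow2_eq0 mul0r.
have avg0 cs h : avg cs (fun=> 0) h = 0 :> R.
  by elim: cs h => //= c cs IH h; rewrite !IH addr0 mul0r.
rewrite avg0 => ->//.
- rewrite psumE (perm_big [:: [ffun=> 0%N]]) /=; last first.
    apply: uniq_perm => //; first exact: box_uniq.
    move=> x; rewrite mem_box inE; apply/forallP/eqP => [x0|-> j]; last by rewrite ffunE.
    by apply/ffunP => j; rewrite ffunE; apply/eqP; rewrite -leqn0; exact: x0.
  rewrite big_seq1 walsh0 mulr1; congr (a _); apply/ffunP => j.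
  by rewrite !ffunE addn0.
- move=> j p; rewrite /pow2 expn0; case: p => [|p] //=.
  by rewrite addn0 mK.
Qed.

End SupportedSeries.

Theorem theorem5 (R : realType) (d : nat) (hd : (2 <= d)%N)
    (n : nat -> mindex d)
    (* (i) the index of the lowest nonzero binary digit of n_i^j tends to infinity *)
    (hlow : forall M : nat, exists I : nat, forall i : nat, (I <= i)%N ->
        forall j : 'I_d, (M <= logn 2 (n i j))%N)
    (* (ii) n_i lies in the block B_{k_i}, with k_i -> oo *)
    (hblock : exists k : nat -> nat,
        (forall M : nat, exists I : nat, forall i : nat, (I <= i)%N -> (M <= k i)%N) /\
        (forall i : nat, forall j : 'I_d, (2 ^ k i <= n i j < 2 ^ (k i).+1)%N)) :
  let F : dpoint d -> Prop := fun g => forall i : nat, walsh R (n i) g = 1 in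
  (exists lam : R, 1 <= lam <= 2 /\ U_set_lambda lam F) /\
  ((forall i : nat, forall j j' : 'I_d, n i j = n i j') -> U_set_cube R F).
Proof.
move=> F; case: hblock => k [k_oo n_block].
have d_gt0 : (0 < d)%N by apply: ltnW.
have n_large M : exists I, forall i, (I <= i)%N -> forall j, (M <= n i j)%N.
  have [I kI] := k_oo M; exists I => i /kI Mk j; have /andP[le _] := n_block i j.
  by apply: leq_trans (leq_trans Mk _) le; apply/ltnW/ltn_expl.
split.
  exists 2; split; first by apply/andP; split; lra.
  move=> a cvg; apply: (coef_eq0 a n k) => //.
    move=> g nF eps eps0; have [M ltM] := cvg g nF eps eps0.
    exists M => s Ms; apply: ltM => [j|j j'].
      by apply: leq_trans Ms _; apply/ltnW/ltn_expl.
    by rewrite ler_peMl // ler1n.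
  move=> g nF t eps eps0; have [M ltM] := cvg g nF eps eps0.
  have [I1 nI1] := n_large M; have [I2 low] := hlow t.
  exists (maxn I1 I2) => i; rewrite geq_max => /andP[i1 i2]; apply: ltM => [j|j j'].
    by apply: leq_trans (nI1 _ i1 j) _; apply: leq_addr.
  (* Both [n i j] and [2 ^ (k i).+1] are multiples of [2 ^ t], so the positive gap between them is
     at least [2 ^ t]. *)
  have upper : (n i j + 2 ^ t <= 2 ^ (k i).+1)%N.
    have /andP[le lt] := n_block i j.
    have n0 : (0 < n i j)%N by apply: leq_trans le; rewrite expn_gt0.
    have tn : (2 ^ t %| n i j)%N by rewrite pfactor_dvdn ?low.
    have tk : (t <= (k i).+1)%N.
      have := leq_ltn_trans (dvdn_leq n0 tn) lt; rewrite ltn_exp2l //; exact: ltnW.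
    move: lt; rewrite -(divnK tn) -(subnK tk) expnD ltn_pmul2r ?expn_gt0 // => lt.
    by rewrite addnC -mulSn leq_pmul2r ?expn_gt0.
  rewrite -natrM ler_nat; apply: leq_trans upper _.
  by rewrite expnS leq_mul2l /=; have /andP[le _] := n_block i j'; apply: leq_trans le (leq_addr _ _).
move=> diag a cvg; apply: (coef_eq0 a n k) => //.
  move=> g nF eps eps0; have [M ltM] := cvg g nF eps eps0.
  exists M => s Ms; apply: ltM.
  by apply: leq_trans Ms _; apply/ltnW/ltn_expl.
move=> g nF t eps eps0; have [M ltM] := cvg g nF eps eps0.
have [I nI] := n_large M; exists I => i Ii.
pose j0 := Ordinal d_gt0.
rewrite (_ : (fun j => _) = (fun=> (n i j0 + 2 ^ t)%N)).
  by apply: ltM; apply: leq_trans (nI _ Ii j0) (leq_addr _ _).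
by apply/funext => j; rewrite (diag i j j0).
Qed.
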